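(* Let $r\ge 1$, $p\ge 1$, $n\ge 1$ and $a\ge 0$ be integers. Then \[ \sum_{k=1}^n k^a\big(H_k^{(r)}\big)^p = \big(H_n^{(r)}\big)^p\big(\delta_{a,0} + \zeta_n(-a)\big) -\sum_{j=0}^a \frac{1}{j+1} \binom{a}{j} B_{a-j}\sum_{I\vDash p}\binom{p}{I}\,\zeta_n\big(D^{j+1}z_{rI}\big), \] where for a composition $I=(i_1,\dots,i_d)$ we write $rI$ for $(ri_1,\dots,ri_d)$.
   Context: For a positive integer $n$ and arbitrary integers $a_1,\dots,a_k$ (possibly zero or negative), the truncated multiple zeta value is $\zeta_n(a_1,\dots,a_k)=\sum_{n\ge n_1>n_2>\dots>n_k\ge 1} n_1^{-a_1}n_2^{-a_2}\cdots n_k^{-a_k}$ (an empty sum is $0$). In particular $\zeta_n(-a)=\sum_{i=1}^n i^a$ and $\zeta_n(0)=n$. The generalized harmonic number is $H_n^{(r)}=\zeta_n(r)=\sum_{i=1}^n i^{-r}$. Consider words in letters $z_i$, $i\in\mathbb Z$, with empty word $\mathbf 1$; for a string of integers $I=(i_1,\dots,i_d)$ put $z_I=z_{i_1}\cdots z_{i_d}$. Extend $\zeta_n$ to a linear map on the $\mathbb Q$-span of words by $\zeta_n(\mathbf 1)=1$ and $\zeta_n(z_{i_1}\cdots z_{i_d})=\zeta_n(i_1,\dots,i_d)$. $D$ is the linear map with $D(\mathbf 1)=0$ and $D(z_{i_1}z_{i_2}\cdots z_{i_d})=z_{i_1-1}z_{i_2}\cdots z_{i_d}$. $I\vDash p$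 means that $I$ is a composition of $p$ (an ordered tuple of positive integers with sum $p$), and $\binom{p}{I}=\frac{p!}{i_1!\cdots i_d!}$ is the multinomial coefficient. $B_m$ is the $m$th Bernoulli number, with the convention $B_1=-\frac12$. $\delta$ is the Kronecker delta. *)

(* Defs.v *)
From HB Require Import structures.
From mathcomp Require Import all_boot all_order all_algebra.
From mathcomp Require Import freeg.

Set Implicit Arguments.
Unset Strict Implicit.
Unset Printing Implicit Defensive.

Import Order.TTheory GRing.Theory Num.Theory.

Local Open Scope ring_scope.

(** The word z_{i_1} ... z_{i_d} is encoded as the sequence [:: i_1; ...; i_d],
    and the Q-span of all words is the free module [words]. *)
Definition words := {freeg (seq int) / rat}.

Definition word (w : seq int) : words := << w >>.

(** The sum ranges over the decreasing tuples n >= n_1 > ... > n_k >= 1, with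
    [`_] indexing from 0.  For k = 0 the only tuple is the empty one and the
    value is 1, which is the value wanted at the empty word. *)
Definition tmzv (n : nat) (a : seq int) : rat :=
  \sum_(t : (size a).-tuple 'I_n.+1
        | sorted gtn [seq val i | i <- t] && all (fun i => 0 < val i)%N t)
    \prod_(j < size a) (val (tnth t j))%:R ^ (- a`_j).

Definition harmonic (r n : nat) : rat := tmzv n [:: r%:Z].

Definition zeta (n : nat) : words -> rat := fglift (tmzv n : seq int -> rat^o).

Definition Dword (w : seq int) : words :=
  if w is i :: s then word (i - 1 :: s) else 0.

Definition D : words -> words := fglift Dword.

(** [bernoulli_seq m] lists B_0, ..., B_(m-1); [bernoulliE] below is the
    characteristic recurrence, and [bernoulli1] fixes the sign convention. *)
Fixpoint bernoulli_seq (m : nat) : seq rat :=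
  if m is m'.+1 then
    let s := bernoulli_seq m' in
    rcons s ((m' == 0%N)%:R -
             m'.+1%:R^-1 * \sum_(k < m') 'C(m'.+1, k)%:R * s`_k)
  else [::].

Definition bernoulli (m : nat) : rat := (bernoulli_seq m.+1)`_m.

Definition is_composition (p : nat) (c : seq nat) : bool :=
  all (fun i => 0 < i)%N c && (sumn c == p).

(** A composition of p.+1 either starts with 1, followed by a composition of p,
    or is obtained by incrementing the first part of a nonempty composition
    of p.  [mem_compositions] and [compositions_uniq] show that this lists each
    composition exactly once. *)
Fixpoint compositions (p : nat) : seq (seq nat) :=
  if p is p'.+1 then
    [seq 1%N :: c | c <- compositions p'] ++
    [seq incr_nth c 0 | c <- compositions p' & c != [::]]
  else [:: [::]].

Definition multinomial (p : nat) (c : seq nat) : rat :=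
  p`!%:R / \prod_(i <- c) i`!%:R.

Definition scale_comp (r : nat) (c : seq nat) : seq int :=
  [seq (r * i)%:Z | i <- c].

Section FreeLift.

Variables (M : lmodType rat) (f : seq int -> M).

Lemma fglift_word w : fglift f (word w) = f w.
Proof. by rewrite /word liftU scale1r. Qed.

Lemma fglift_linear : linear (fglift f : words -> M).
Proof.
pose Fadd := GRing.isAdditive.Build words M (fglift f) (lift_is_additive f).
pose F : {additive words -> M} := HB.pack (fglift f : words -> M) Fadd.
move=> c x y; rewrite -[fglift f]/(F : _ -> _) raddfD; congr (_ + _).
have -> : F x = \sum_(w <- dom x) F << coeff w x *g w >>.
  by rewrite -[in LHS](freeg_sumE x) raddf_sum.
rewrite [c *: x]/(fgscale c x) /fgscale raddf_sum scaler_sumr.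
by apply: eq_bigr => w _; rewrite /F /= !liftU scalerA.
Qed.

End FreeLift.

Lemma zeta_linear n : linear (zeta n : words -> rat^o).
Proof. exact: fglift_linear. Qed.

Lemma zeta_word n w : zeta n (word w) = tmzv n w.
Proof. exact: (@fglift_word rat^o). Qed.

Lemma D_linear : linear D.
Proof. exact: fglift_linear. Qed.

Lemma D_nil : D (word [::]) = 0.
Proof. exact: fglift_word. Qed.

Lemma D_cons i s : D (word (i :: s)) = word (i - 1 :: s).
Proof. exact: fglift_word. Qed.

Lemma tmzv_nil n : tmzv n [::] = 1.
Proof.
rewrite /tmzv (big_pred1 [tuple]) ?big_ord0 // => t.
by rewrite tuple0 /= eqxx.
Qed.

Lemma tmzv1 n i : tmzv n [:: i] = \sum_(1 <= m < n.+1) m%:R ^ (- i).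
Proof.
rewrite /tmzv (reindex (fun m : 'I_n.+1 => [tuple m])) /=; last first.
  exists (fun t => thead t) => [m _|t _]; first by [].
  by apply: val_inj; case/tupleP: t => m t; rewrite theadE (tuple0 t).
rewrite big_mkcond big_ord_recl /= add0r big_add1 /= big_mkord.
by apply: eq_bigr => m _; rewrite big_ord1.
Qed.


Lemma size_bernoulli_seq m : size (bernoulli_seq m) = m.
Proof. by elim: m => //= m IH; rewrite size_rcons IH. Qed.

Lemma nth_bernoulli_seq m k : (k < m)%N -> (bernoulli_seq m)`_k = bernoulli k.
Proof.
elim: m => // m IH; rewrite ltnS leq_eqVlt => /orP[/eqP->//|lt_km].
by rewrite /= nth_rcons size_bernoulli_seq lt_km IH.
Qed.

Lemma bernoulliE m :
  \sum_(k < m.+1) 'C(m.+1, k)%:R * bernoulli k = (m == 0%N)%:R :> rat.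
Proof.
rewrite big_ord_recr /= binSn {2}/bernoulli /= nth_rcons size_bernoulli_seq.
rewrite ltnn eqxx mulrBr mulrA mulfV ?pnatr_eq0 // mul1r.
under [in X in _ + (_ - X)]eq_bigr => k _ do rewrite nth_bernoulli_seq //.
by rewrite addrC subrK; case: m => [|m]; rewrite ?mul1r ?mulr0.
Qed.

Lemma bernoulli1 : bernoulli 1 = - 2^-1.
Proof.
have b0 : bernoulli 0 = 1.
  by have := bernoulliE 0; rewrite big_ord_recr big_ord0 /= add0r mul1r.
have := bernoulliE 1.
rewrite !big_ord_recr big_ord0 /= add0r bin0 bin1 b0 !mul1r => /eqP.
rewrite addrC addr_eq0 => /eqP b1.
by apply: (@mulfI _ 2%:R) => //; rewrite b1 mulrN mulfV.
Qed.

Lemma mem_compositions p c : (c \in compositions p) = is_composition p c.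
Proof.
rewrite /is_composition; elim: p c => [|p IH] c /=.
  by rewrite inE; case: c => //= -[|i] c //=; rewrite addSn andbF.
rewrite mem_cat; apply/orP/idP.
  case=> /mapP[J].
    by rewrite IH => /andP[aJ /eqP sJ] -> /=; rewrite aJ sJ eqxx.
  rewrite mem_filter IH; case: J => //= j J /andP[/andP[_ aJ] /eqP sJ] -> /=.
  by rewrite aJ addSn sJ eqxx.
case: c => [|[|[|i]] c] //= /andP[aI]; rewrite ?add1n ?addSn eqSS => sI.
  by left; apply/mapP; exists c; rewrite // IH aI.
by right; apply/mapP; exists (i.+1 :: c); rewrite // mem_filter IH /= aI addSn.
Qed.

Lemma compositions_uniq p : uniq (compositions p).
Proof.
elim: p => //= p IH; rewrite cat_uniq map_inj_uniq ?IH //=; last by move=> ? ? [].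
apply/andP; split.
  apply/hasPn => J /mapP[K]; rewrite mem_filter mem_compositions.
  case: K => //= k K /andP[/andP[k0 _] _] ->.
  by apply/negP => /mapP[L _ [ek _]]; rewrite ek in k0.
rewrite map_inj_in_uniq ?filter_uniq // => J K.
by rewrite !mem_filter; case: J K => // j J [|k K] //= _ _ [-> ->].
Qed.

(* Main.v *)
Require Import Defs.
From mathcomp Require Import all_boot all_order all_algebra.
From mathcomp Require Import ring zify.
Import GRing.Theory Num.Theory.
Local Open Scope ring_scope.

(** The identity is a summation by parts.  Write [H] for the harmonic numbers
    and [T m] for the sum of [i ^ a] over [0 <= i < m].  Since [H 0 = 0] and
    [p] is positive,
      [sum_k k^a H_k^p = H_n^p T(n+1) - sum_(m <= n) (H_m^p - H_(m-1)^p) T(m)],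
    and [T (n+1)] is [zeta_n (- a)] plus the term [0 ^ a], which is the
    Kronecker delta.  Two facts then turn the last sum into the one wanted.

    By Faulhaber's formula ([faulhaber]), [T m] is a combination of the powers
    [m ^ (j+1)], with the Bernoulli coefficients of the theorem.

    Expanding [H_m^p] and grouping the tuples of summation indices by the order
    pattern of their entries gives [H_m^p] as the sum over compositions [I] of
    [p] of the multinomial coefficient times [zeta_m (z_(rI))]
    ([harmonic_expn]).  In [zeta_m (z_i w) - zeta_(m-1) (z_i w)] only the tuples
    with largest entry [m] remain, so multiplying this increment by [m ^ (j+1)]
    lowers the first exponent by [j+1]; summing over [m <= n] therefore gives
    [zeta_n] of the word to which [D] has been applied [j+1] times
    ([sum_tmzv_increment]). *)

(** * Recursion for truncated multiple zeta values *)

(** Once the largest index [m] is chosen, the remaining ones are bounded by [m]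
    instead of [n].  Varying the bound [b] while keeping the index type
    ['I_n.+1] lets this recursion stay inside one type. *)
Definition tmzv_below (n b : nat) (s : seq int) : rat :=
  \sum_(t : (size s).-tuple 'I_n.+1
        | [&& sorted gtn [seq val i | i <- t], all (fun i => 0 < val i)%N t
            & all (fun i => val i < b)%N t])
    \prod_(j < size s) (val (tnth t j))%:R ^ (- s`_j).

Lemma tmzv_belowT n s : tmzv_below n n.+1 s = tmzv n s.
Proof.
apply: eq_bigl => t; rewrite andbA; apply/andb_idr => _.
by apply/allP => i _; apply: ltn_ord.
Qed.

Lemma tmzv_below_nil n b : tmzv_below n b [::] = 1.
Proof.
rewrite /tmzv_below (big_pred1 [tuple]) ?big_ord0 // => t.
by rewrite tuple0 /= eqxx.
Qed.

Lemma tmzv_below_cons n b i s : (b <= n.+1)%N ->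
  tmzv_below n b (i :: s) =
  \sum_(1 <= m < b) m%:R ^ (- i) * tmzv_below n m s.
Proof.
move=> le_bn.
transitivity (\sum_(m < n.+1 | (0 < m < b)%N)
                m%:R ^ (- i) * tmzv_below n m s); last first.
  rewrite -(big_mkord (fun m => 0 < m < b)%N
              (fun m => m%:R ^ (- i) * tmzv_below n m s)).
  rewrite (big_nat_widen 1 b n.+1) // big_mkcond [RHS]big_mkcond /=.
  by rewrite big_ltn // add0r; apply: eq_big_nat => m /andP[-> _].
under eq_bigr do rewrite /tmzv_below mulr_sumr.
rewrite pair_big_dep /= /tmzv_below.
pose f (x : 'I_n.+1 * (size s).-tuple 'I_n.+1) := [tuple of x.1 :: x.2].
rewrite (reindex f) /=; last first.
  exists (fun t => (thead t, [tuple of behead t])) => [[m t] _|t _].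
    by congr pair; apply: val_inj.
  by apply: val_inj; case/tupleP: t.
apply: eq_big => [[m t]|[m t] _] /=.
  rewrite (path_sortedE (rev_trans ltn_trans)) all_map.
  apply/idP/idP => [/and3P[/andP[a1 a2] /andP[a3 a4] /andP[a5 a6]]|].
    by rewrite a3 a5 a2 a4 a1.
  case/andP => /andP[a1 a2] /and3P[a3 a4 a5].
  rewrite a1 a2 a3 a4 /= andbT; apply/andP; split => //.
  by apply: sub_all a5 => x /= lt_xm; apply: ltn_trans a2.
rewrite big_ord_recl /=; congr (_ * _).
by apply: eq_bigr => j _; rewrite /f /= tnthS.
Qed.

(** The ambient index type is immaterial: for any of them the recursion on the
    first entry gives the same nested sum. *)
Lemma tmzv_below_tmzv n b s : (b <= n)%N -> tmzv_below n b.+1 s = tmzv b s.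
Proof.
elim: s n b => [|i s IH] n b le_bn; first by rewrite tmzv_below_nil tmzv_nil.
rewrite -tmzv_belowT !tmzv_below_cons //.
apply: eq_big_nat => -[//|m] /andP[_ lt_mb].
by rewrite !IH //; apply: ltnW => //; apply: leq_trans le_bn.
Qed.

Lemma tmzv_cons n i s :
  tmzv n (i :: s) = \sum_(1 <= m < n.+1) m%:R ^ (- i) * tmzv m.-1 s.
Proof.
rewrite -tmzv_belowT tmzv_below_cons //.
apply: eq_big_nat => -[//|m] /andP[_ lt_mn].
by rewrite tmzv_below_tmzv //; apply: ltnW.
Qed.

Lemma tmzv0_cons i s : tmzv 0 (i :: s) = 0.
Proof. by rewrite tmzv_cons big_geq. Qed.

Lemma tmzvS_cons n i s :
  tmzv n.+1 (i :: s) = tmzv n (i :: s) + n.+1%:R ^ (- i) * tmzv n s.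
Proof. by rewrite !tmzv_cons big_nat_recr. Qed.

(** The increment at [m] carries the factor [m ^ (- i)] of the largest index,
    and [m ^ k] is absorbed by it. *)
Lemma sum_tmzv_increment n k i s :
  \sum_(1 <= m < n.+1)
    m%:R ^+ k * (tmzv m (i :: s) - tmzv m.-1 (i :: s))
  = tmzv n (i - k%:Z :: s).
Proof.
rewrite tmzv_cons; apply: eq_big_nat => -[//|m] _ /=.
rewrite tmzvS_cons addrAC subrr add0r mulrA; congr (_ * _).
by rewrite exprnP -expfzDr ?pnatr_eq0 // opprB.
Qed.

Lemma zeta_iter_D n k i s :
  zeta n (iter k D (word (i :: s))) = tmzv n (i - k%:Z :: s).
Proof.
suff -> : iter k D (word (i :: s)) = word (i - k%:Z :: s) by rewrite zeta_word.
elim: k => [|k IH] /=; first by rewrite subr0.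
by rewrite IH D_cons; congr (word (_ :: s)); lia.
Qed.

(** * Powers of harmonic numbers *)

(** Splitting by the first part.  In the recursive enumeration a composition of
    [p.+2] with first part above 1 arises by incrementing the first part of one
    of [p.+1], hence the induction with [F] generalized. *)
Lemma big_compositionsS (F : seq nat -> rat) p :
  \sum_(c <- compositions p.+1) F c =
  \sum_(i < p.+1) \sum_(c <- compositions (p - i)) F (i.+1 :: c).
Proof.
elim: p F => [|p IH] F.
  by rewrite big_ord1 subn0 /= !big_seq1.
rewrite [compositions p.+2]/= -/(compositions p.+1) big_cat /= !big_map.
rewrite [RHS]big_ord_recl subn0; congr (_ + _).
rewrite big_filter big_seq_cond.
(* Every composition of a positive number is nonempty. *)
rewrite (eq_bigl (fun c => c \in compositions p.+1)); last first.
  by move=> c; rewrite mem_compositions; case: c => //= *; rewrite andbT.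
by rewrite -big_seq IH.
Qed.

Lemma multinomial_cons p i c : (i <= p)%N ->
  multinomial p (i :: c) = 'C(p, i)%:R * multinomial (p - i) c.
Proof.
move=> le_ip; rewrite /multinomial big_cons invfM mulrA [RHS]mulrA.
congr (_ * _); rewrite -(bin_fact le_ip) !natrM.
have := fact_gt0 i; rewrite lt0n -(eqr_nat rat) => nz_i.
by field.
Qed.

Lemma harmonic0 r : harmonic r 0 = 0.
Proof. exact: tmzv0_cons. Qed.

Lemma harmonicS r n : harmonic r n.+1 = harmonic r n + n.+1%:R ^ (- r%:Z).
Proof. by rewrite /harmonic tmzvS_cons tmzv_nil mulr1. Qed.

(** Adding [x = (n+1)^(-r)] to the harmonic number, the binomial theorem selects
    the power [x ^ i] with coefficient ['C(p, i)]; on the other side this is the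
    contribution of the compositions whose first part is [i], that part being
    the number of factors of the product that attain the largest index. *)
Lemma harmonic_expn r n p :
  harmonic r n ^+ p =
  \sum_(c <- compositions p) multinomial p c * tmzv n (scale_comp r c).
Proof.
elim: n p => [|n IH] [|p].
- by rewrite expr0 big_seq1 /multinomial big_nil tmzv_nil divr1.
- rewrite harmonic0 expr0n /= big_compositionsS big1 // => i _.
  by rewrite big1 // => c _; rewrite tmzv0_cons mulr0.
- by rewrite expr0 big_seq1 /multinomial big_nil tmzv_nil divr1.
rewrite harmonicS exprDn big_ord_recl /= subn0 bin0 mulr1n mulr1 (IH p.+1).
rewrite !big_compositionsS -big_split /=; apply: eq_bigr => i _.
rewrite /bump add1n subSS IH -mulrnAr mulr_suml -big_split /=.
apply: eq_bigr => c _; rewrite tmzvS_cons mulrDr; congr (_ + _).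
rewrite multinomial_cons // subSS -mulr_natl PoszM -mulNr -exprz_exp -exprnP.
ring.
Qed.

(** * Faulhaber's formula *)

(** Both sides are [a! / (l! (a-j)! (j+1-l)!)].  The right-hand form isolates
    the dependence on [j] in one binomial coefficient, the one that multiplies
    [B_(a-j)] in the recurrence for the Bernoulli numbers. *)
Lemma bin_trinomial a j l : (l <= j <= a)%N ->
  j.+1%:R^-1 * 'C(a, j)%:R * 'C(j.+1, l)%:R =
  'C(a, l)%:R / (a - l).+1%:R * 'C((a - l).+1, a - j)%:R :> rat.
Proof.
case/andP => le_lj le_ja.
have nz k : k`!%:R != 0 :> rat by rewrite pnatr_eq0 -lt0n fact_gt0.
have binE m k : (k <= m)%N ->
    'C(m, k)%:R = m`!%:R / (k`!%:R * (m - k)`!%:R) :> rat.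
  by move=> le_km; rewrite -(bin_fact le_km) !natrM mulfK ?mulf_neq0.
rewrite !binE; try lia.
have -> : ((a - l).+1 - (a - j) = j.+1 - l)%N by lia.
rewrite !factS !natrM.
field.
by rewrite !nz -!mulrS !pnatr_eq0.
Qed.

(** Expand the difference of powers by the binomial theorem and collect the
    coefficient of [m ^ l]: by [bin_trinomial] it is a multiple of the left side
    of the Bernoulli recurrence of order [a - l], so only [l = a] survives. *)
Lemma faulhaber_step a m :
  \sum_(j < a.+1) j.+1%:R^-1 * 'C(a, j)%:R * bernoulli (a - j) *
     (m.+1%:R ^+ j.+1 - m%:R ^+ j.+1) = m%:R ^+ a :> rat.
Proof.
have expand j : m.+1%:R ^+ j.+1 - m%:R ^+ j.+1
    = \sum_(l < j.+1) 'C(j.+1, l)%:R * m%:R ^+ l :> rat.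
  rewrite -[m.+1]add1n natrD exprDn big_ord_recr /= subnn expr0 mul1r binn.
  rewrite addrK.
  by apply: eq_bigr => l _; rewrite expr1n mul1r mulr_natl.
under eq_bigr => j _.
  rewrite expand (big_ord_widen a.+1
    (fun l => 'C(j.+1, l)%:R * m%:R ^+ l : rat)) ?ltn_ord // mulr_sumr.
  over.
rewrite (exchange_big_dep xpredT) //=.
transitivity (\sum_(l < a.+1) 'C(a, l)%:R / (a - l).+1%:R *
    (\sum_(j < a.+1 | (l < j.+1)%N)
        'C((a - l).+1, a - j)%:R * bernoulli (a - j)) * m%:R ^+ l : rat).
  apply: eq_bigr => l _; rewrite mulr_sumr mulr_suml.
  apply: eq_bigr => j le_lj.
  have /bin_trinomial E : (l <= j <= a)%N.
    by apply/andP; split; rewrite -ltnS // ltn_ord.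
  by rewrite [_ / _ * (_ * _)]mulrA -E; ring.
have inner (l : 'I_a.+1) :
    \sum_(j < a.+1 | (l < j.+1)%N) 'C((a - l).+1, a - j)%:R * bernoulli (a - j)
    = (l == ord_max)%:R :> rat.
  have -> : (l == ord_max) = (a - l == 0)%N.
    by rewrite -val_eqE /= subn_eq0 eqn_leq -ltnS ltn_ord.
  rewrite -bernoulliE.
  (* The recurrence is indexed by k = a - j. *)
  rewrite (reindex_inj rev_ord_inj) /= [RHS](big_ord_widen a.+1
    (fun k => 'C((a - l).+1, k)%:R * bernoulli k)) ?ltnS ?leq_subr //.
  apply: eq_big => [k|k _]; first by have := ltn_ord k; have := ltn_ord l; lia.
  by rewrite subSS subKn // -ltnS ltn_ord.
under eq_bigr do rewrite inner.
rewrite big_ord_recr /= big1 => [|l _].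
  by rewrite eqxx add0r subnn binn divr1 !mul1r.
suff -> : (widen_ord (leqnSn a) l == ord_max) = false by rewrite mulr0 mul0r.
by rewrite -val_eqE /= ltn_eqF.
Qed.

Lemma faulhaber a m :
  \sum_(j < a.+1) j.+1%:R^-1 * 'C(a, j)%:R * bernoulli (a - j) * m%:R ^+ j.+1
  = \sum_(i < m) i%:R ^+ a :> rat.
Proof.
elim: m => [|m IH].
  by rewrite big_ord0 big1 // => j _; rewrite exprS mul0r mulr0.
rewrite [RHS]big_ord_recr /= -IH -(faulhaber_step a m) -big_split /=.
by apply: eq_bigr => j _; rewrite -mulrDr addrC subrK.
Qed.

(** * Summation by parts *)

Lemma sum_by_parts (g h : nat -> rat) n : h 0 = 0 ->
  \sum_(1 <= k < n.+1) g k * h k =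
  h n * \sum_(i < n.+1) g i
  - \sum_(1 <= m < n.+1) (h m - h m.-1) * \sum_(i < m) g i.
Proof.
move=> h0; elim: n => [|n IH]; first by rewrite !big_geq // h0 mul0r subr0.
rewrite !(@big_nat_recr _ _ _ n.+1 1) //= IH.
rewrite [\sum_(i < n.+2) _]big_ord_recr /=; ring.
Qed.

Theorem theorem4p1 (r p n a : nat)
    (hr : (1 <= r)%N) (hp : (1 <= p)%N) (hn : (1 <= n)%N) :
  \sum_(1 <= k < n.+1) k%:R ^+ a * harmonic r k ^+ p
  = harmonic r n ^+ p * ((a == 0%N)%:R + tmzv n [:: - a%:Z])
    - \sum_(j < a.+1)
        j.+1%:R^-1 * 'C(a, j)%:R * bernoulli (a - j) *
        \sum_(c <- compositions p)
          multinomial p c * zeta n (iter j.+1 D (word (scale_comp r c)))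
  :> rat.
Proof.
rewrite (sum_by_parts (fun k => k%:R ^+ a) (fun k => harmonic r k ^+ p));
  last first.
  by rewrite harmonic0 expr0n -[p == _]negbK -lt0n hp.
congr (_ * _ - _).
  rewrite big_ord_recl /= expr0n tmzv1 opprK big_add1 /= big_mkord.
  by congr (_ + _).
under eq_bigr do rewrite -faulhaber mulr_sumr.
rewrite exchange_big /=; apply: eq_bigr => j _.
transitivity (j.+1%:R^-1 * 'C(a, j)%:R * bernoulli (a - j) *
   \sum_(1 <= m < n.+1) m%:R ^+ j.+1 *
      (harmonic r m ^+ p - harmonic r m.-1 ^+ p)).
  by rewrite mulr_sumr; apply: eq_bigr => m _; ring.
congr (_ * _).
under [LHS]eq_bigr do rewrite !harmonic_expn -sumrB mulr_sumr.
rewrite exchange_big /=; apply: eq_big_seq => c.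
rewrite mem_compositions => /andP[_ /eqP sum_c].
case: c sum_c => [p0|i c _]; first by rewrite -p0 in hp.
rewrite -[D (iter j D _)]/(iter j.+1 D _) zeta_iter_D -sum_tmzv_increment.
by rewrite mulr_sumr; apply: eq_bigr => m _; rewrite -mulrBr mulrCA.
Qed.
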